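(* Let $f>0$, and let a particle of mass $m$ and total energy $E$ bounce elastically at the parabolic boundary $$\mathcal B_{P'}:\ y=\frac{x^2}{4f}-f$$ with focal length $f$, under the influence of a constant gravitational force $-mg$ (in the $y$-direction). Let the foci of the flight parabolas of the orbit lie on the foci-circle $x^2+y^2=R^2$. Then the lines $F_iF_{i+1}$ through consecutive foci of flight parabolas are tangent to the circle (foci-caustic circle) $$\mathcal C_1:\ x^2+(y-y_0)^2=r_0^2,$$ where $$y_0=\frac{\left(\frac{E}{mg}+2f\right)^2-R^2}{4f},\qquad r_0^2=\left(\frac{R^2-\left(\frac{E}{mg}\right)^2+4f^2}{4f}\right)^2.$$
   Context: Here $m,g>0$, the potential energy is $mgy$ (zero at $y=0$), so $E=\tfrac12 m|v|^2+mgy$. The boundary parabola has its focus at $F'=(0,0)$. Between reflections the particle moves along a flight parabola; all flight parabolas of an orbit with energy $E$ have the common directrix $y=h_{max}=\frac{E}{mg}$, and $F_i$ denotes the focus of the $i$-th flight parabola. Consecutive flight parabolas share the reflection point $P\in\mathcal B_{P'}$ and their directions at $P$ are related by the elastic reflection law (angle of incidence equals angle of reflection, speed preserved). It is a known first integral of this billiard that all $F_i$ of one orbit lie on a common circle $\mathcal C_0: x^2+y^2=R^2$ centered at $F'$ (the foci-circle), $R\ge0$ being a conserved quantity. The line $F_iF_{i+1}$ is considered when $F_i\ne F_{i+1}$. If $r_0=0$, the circle degenerates to its center and tangency means that the line passes through this center. *)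

(* Defs.v *)
From Stdlib Require Import Reals.
Open Scope R_scope.

Definition point : Type := (R * R)%type.

Definition dot (u v : point) : R := fst u * fst v + snd u * snd v.

Definition distance (p q : point) : R :=
  dist_euc (fst p) (snd p) (fst q) (snd q).

Definition circle (c : point) (rsq : R) (p : point) : Prop :=
  (fst p - fst c) ^ 2 + (snd p - snd c) ^ 2 = rsq.

Definition line_through (a b : point) (p : point) : Prop :=
  exists s : R, p = (fst a + s * (fst b - fst a), snd a + s * (snd b - snd a)).

(** Meeting the circle in exactly one point. When [rsq = 0] the circle is the
    single point [c], and this says that the line passes through [c]. *)
Definition tangent_line_circle (a b c : point) (rsq : R) : Prop :=
  a <> b /\ exists! p : point, line_through a b p /\ circle c rsq p.

Definition boundary_height (f x : R) : R := x ^ 2 / (4 * f) - f.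

Definition on_boundary (f : R) (p : point) : Prop :=
  snd p = boundary_height f (fst p).

Definition inside_boundary (f : R) (p : point) : Prop :=
  boundary_height f (fst p) < snd p.

(** [x / (2 f)] is the slope of the boundary at abscissa [x]. *)
Definition boundary_normal (f : R) (p : point) : point :=
  (- (fst p / (2 * f)), 1).

Definition reflect (n v : point) : point :=
  let k := 2 * dot v n / dot n n in (fst v - k * fst n, snd v - k * snd n).

Definition flight_position (g : R) (p v : point) (t : R) : point :=
  (fst p + fst v * t, snd p + snd v * t - g * t ^ 2 / 2).

Definition flight_velocity (g : R) (v : point) (t : R) : point :=
  (fst v, snd v - g * t).

Definition energy (m g : R) (p v : point) : R :=
  / 2 * m * dot v v + m * g * snd p.

(** Flight [i] starts at [P i] with velocity [V i] and lasts for the time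
    [T i]; it ends with a reflection at [P (S i)]. The initial point [P 0] may
    lie on the boundary or inside it. *)
Record billiard_orbit (g f : R) (P V : nat -> point) (T : nat -> R) : Prop := {
  orbit_time : forall i, 0 < T i;
  orbit_inside : forall i t, 0 < t < T i ->
    inside_boundary f (flight_position g (P i) (V i) t);
  orbit_next : forall i, P (S i) = flight_position g (P i) (V i) (T i);
  orbit_impact : forall i, on_boundary f (P (S i));
  orbit_reflection : forall i,
    V (S i) = reflect (boundary_normal f (P (S i)))
                      (flight_velocity g (V i) (T i))
}.

(** Locus of the points equidistant from the focus [F] and the line [y = d]. If
    [F] lies on that line, this is the vertical line through [F]. *)
Definition parabola (F : point) (d : R) (p : point) : Prop :=
  distance p F = Rabs (snd p - d).

(** The whole free-fall curve, extended to all times, lies on the parabola with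
    focus [F] and directrix [y = d]. For a vertical flight the curve is a
    half-line, and [F] is its highest point when [d] is the height reached. *)
Definition flight_focus (g d : R) (p v F : point) : Prop :=
  forall t : R, parabola F d (flight_position g p v t).

(* Main.v *)
(** Let [P] be the reflection point between two consecutive flights, with foci
    [A] and [B].  Both flight parabolas pass through [P] and share their
    directrix, so [|PA| = |PB|]; as also [|A| = |B| = R], the line [AB] is
    orthogonal to [P].  Since [P] lies on the boundary parabola, [|P| = y + 2f]
    where [y] is its height, and the distance from [(0, y0)] to the line [AB]
    comes out as [|R^2 - h^2 + 4 f^2| / (4 f)], independently of [P]. *)

Require Import Defs.
From Stdlib Require Import Reals Lra.
Open Scope R_scope.

Lemma parabola_sqr (F : point) (d : R) (p : point) :
  parabola F d p ->
  (fst p - fst F) ^ 2 + (snd p - snd F) ^ 2 = (snd p - d) ^ 2.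
Proof.
unfold parabola, distance, dist_euc; intros H.
apply (f_equal Rsqr) in H.
rewrite Rsqr_sqrt, <- Rsqr_abs in H.
- unfold Rsqr in H; nra.
- apply Rplus_le_le_0_compat; apply Rle_0_sqr.
Qed.

Lemma flight_position_0 (g : R) (p v : point) : flight_position g p v 0 = p.
Proof. destruct p; unfold flight_position; simpl; f_equal; field. Qed.

(** The boundary is the parabola with focus at the origin and directrix [y = - 2 f]. Positivity
    keeps [p] away from the origin, so that it can serve as a normal vector. *)
Lemma on_boundary_norm (f : R) (p : point) :
  0 < f -> on_boundary f p ->
  dot p p = (snd p + 2 * f) ^ 2 /\ 0 < snd p + 2 * f.
Proof.
unfold on_boundary, boundary_height, dot; intros hf H.
assert (Hx : fst p ^ 2 = 4 * f * (snd p + f)) by (rewrite H; field; lra).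
split; nra.
Qed.

(** The cross product is [|b - a|] times the signed distance from [c] to the line; by Pythagoras
    only the foot of the perpendicular lies on the circle, even for [rsq = 0]. *)
Lemma tangent_line_of_cross (a b c : point) (rsq : R) :
  a <> b ->
  ((fst b - fst a) * (snd c - snd a) - (snd b - snd a) * (fst c - fst a)) ^ 2
    = rsq * ((fst b - fst a) ^ 2 + (snd b - snd a) ^ 2) ->
  tangent_line_circle a b c rsq.
Proof.
destruct a as [a1 a2], b as [b1 b2], c as [c1 c2]; simpl fst; simpl snd.
intros hab hcross; split; [exact hab|].
set (D := (b1 - a1) ^ 2 + (b2 - a2) ^ 2) in *.
assert (hD : 0 < D).
{ pose proof (pow2_ge_0 (b1 - a1)) as h1; pose proof (pow2_ge_0 (b2 - a2)) as h2.
  destruct (Req_dec (b1 - a1) 0) as [e1|n1];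
    [destruct (Req_dec (b2 - a2) 0) as [e2|n2]|].
  - destruct hab; f_equal; lra.
  - pose proof (Rsqr_pos_lt _ n2) as h; rewrite Rsqr_pow2 in h; unfold D; lra.
  - pose proof (Rsqr_pos_lt _ n1) as h; rewrite Rsqr_pow2 in h; unfold D; lra. }
set (s0 := ((c1 - a1) * (b1 - a1) + (c2 - a2) * (b2 - a2)) / D).
(* [s0] is the parameter of the foot of the perpendicular from [c]. *)
assert (hdist : forall s,
  (a1 + s * (b1 - a1) - c1) ^ 2 + (a2 + s * (b2 - a2) - c2) ^ 2
  = rsq + (s - s0) ^ 2 * D).
{ intros s.
  apply (Rmult_eq_reg_r D); [|lra].
  replace ((rsq + (s - s0) ^ 2 * D) * D)
    with (rsq * D + (s * D - s0 * D) ^ 2) by ring.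
  replace (s0 * D) with ((c1 - a1) * (b1 - a1) + (c2 - a2) * (b2 - a2))
    by (unfold s0; field; lra).
  (* Lagrange's identity for [b - a] and [c - a]. *)
  rewrite <- hcross; unfold D; ring. }
exists (a1 + s0 * (b1 - a1), a2 + s0 * (b2 - a2)); split.
- split; [now exists s0|].
  unfold circle; simpl fst; simpl snd; rewrite hdist; ring.
- intros q [[s ->] hq].
  unfold circle in hq; simpl fst in hq; simpl snd in hq; rewrite hdist in hq.
  assert (hs : s = s0).
  { assert (h0 : (s - s0) ^ 2 * D = 0) by lra.
    apply Rmult_integral in h0 as [h0|h0]; [|lra].
    rewrite <- Rsqr_pow2 in h0; apply Rsqr_0_uniq in h0; lra. }
  now rewrite hs.
Qed.

Lemma tangent_line_of_normal (a b c n : point) (rsq : R) :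
  a <> b -> 0 < dot n n -> dot n a = dot n b ->
  (dot n c - dot n a) ^ 2 = rsq * dot n n ->
  tangent_line_circle a b c rsq.
Proof.
destruct a as [a1 a2], b as [b1 b2], c as [c1 c2], n as [n1 n2].
unfold dot; simpl fst; simpl snd; intros hab hn horth hdist.
apply tangent_line_of_cross; [exact hab|]; simpl fst; simpl snd.
apply (Rmult_eq_reg_l (n1 * n1 + n2 * n2)); [|lra].
set (d1 := b1 - a1); set (d2 := b2 - a2).
set (e1 := c1 - a1); set (e2 := c2 - a2).
assert (hd : n1 * d1 + n2 * d2 = 0) by (unfold d1, d2; lra).
assert (he : (n1 * e1 + n2 * e2) ^ 2 = rsq * (n1 * n1 + n2 * n2))
  by (rewrite <- hdist; unfold e1, e2; ring).
(* The Gram determinant of the three plane vectors [n], [d], [e] vanishes. *)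
assert (hgram : (n1 * n1 + n2 * n2) * (d1 * e2 - d2 * e1) ^ 2
  = (n1 * e1 + n2 * e2) ^ 2 * (d1 ^ 2 + d2 ^ 2)
    + (n1 * d1 + n2 * d2)
      * ((e1 ^ 2 + e2 ^ 2) * (n1 * d1 + n2 * d2)
         - 2 * (d1 * e1 + d2 * e2) * (n1 * e1 + n2 * e2))) by ring.
rewrite hgram, hd, he; ring.
Qed.

(** Expand [|P - A|^2]. The resulting value is the same for both foci, hence the orthogonality. *)
Lemma dot_reflection_point (P A : point) (f h R0 : R) :
  dot P P = (snd P + 2 * f) ^ 2 -> circle (0, 0) (R0 ^ 2) A ->
  parabola A h P ->
  dot P A = (R0 ^ 2 + (snd P + 2 * f) ^ 2 - (snd P - h) ^ 2) / 2.
Proof.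
intros hP hA hPA; apply parabola_sqr in hPA.
rewrite <- hP, <- hPA, <- hA; unfold dot; simpl fst; simpl snd; field.
Qed.

Theorem theorem6p1 (m g f E R0 : R) (P V F : nat -> point) (T : nat -> R)
  (hm : 0 < m) (hg : 0 < g) (hf : 0 < f) (hR0 : 0 <= R0)
  (horbit : billiard_orbit g f P V T)
  (henergy : energy m g (P 0%nat) (V 0%nat) = E)
  (hfocus : forall i : nat, flight_focus g (E / (m * g)) (P i) (V i) (F i))
  (hcircle : forall i : nat, circle (0, 0) (R0 ^ 2) (F i)) :
  forall i : nat, F i <> F (S i) ->
    tangent_line_circle (F i) (F (S i))
      (0, ((E / (m * g) + 2 * f) ^ 2 - R0 ^ 2) / (4 * f))
      (((R0 ^ 2 - (E / (m * g)) ^ 2 + 4 * f ^ 2) / (4 * f)) ^ 2).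
Proof.
intros i hne.
destruct horbit as [_ _ hnext himpact _].
destruct (on_boundary_norm f (P (S i)) hf (himpact i)) as [hP hpos].
(* [P (S i)] ends flight [i] and is the time-zero point of flight [S i]. *)
assert (hA : parabola (F i) (E / (m * g)) (P (S i)))
  by (rewrite hnext; apply hfocus).
assert (hB : parabola (F (S i)) (E / (m * g)) (P (S i)))
  by (rewrite <- (flight_position_0 g (P (S i)) (V (S i))); apply hfocus).
pose proof (dot_reflection_point _ _ _ _ _ hP (hcircle i) hA) as hdA.
pose proof (dot_reflection_point _ _ _ _ _ hP (hcircle (S i)) hB) as hdB.
apply (tangent_line_of_normal _ _ _ (P (S i))); [exact hne| | |].
- rewrite hP; nra.
- now rewrite hdA, hdB.
(* With [y] the height of [P (S i)], the difference on the left is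
   [- (y + 2 f) (R0^2 - h^2 + 4 f^2) / (4 f)]; the factor [y + 2 f] is the length of the normal. *)
- rewrite hP, hdA; unfold dot; simpl fst; simpl snd.
  set (h := E / (m * g)).
  field; lra.
Qed.
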